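(* Let $(\mathfrak{g},\mathfrak{h},\phi)$ be a morphism Lie algebra (finite-dimensional, over $\mathbb{R}$), let $(\mathfrak{p},\mathfrak{q},\varphi)\hookrightarrow(\mathfrak{g},\mathfrak{h},\phi)$ be a morphism Lie subalgebra, $\varphi=\phi|_{\mathfrak{p}}$, and let $(\mathfrak{p}_t,\mathfrak{q}_t)$ be a deformation of $(\mathfrak{p},\mathfrak{q},\phi|_{\mathfrak{p}})$. Then $$(\dot{\mathfrak{p}}_0,\dot{\mathfrak{q}}_0,0)\in\mathrm{Hom}(\mathfrak{p},\mathfrak{g}/\mathfrak{p})\oplus\mathrm{Hom}(\mathfrak{q},\mathfrak{h}/\mathfrak{q})\oplus\mathfrak{h}/\mathfrak{q}=C^1_{\mathsf{mLA}}(\varphi,\phi/\varphi)$$ is a $1$-cocycle, i.e. lies in $Z^1_{\mathsf{mLA}}(\varphi,\phi/\varphi)$. Moreover, the corresponding cohomology class in $H^1_{\mathsf{mLA}}(\varphi,\phi/\varphi)$ depends only on the equivalence class of the deformation.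
   Context: A morphism Lie algebra is a triple $(\mathfrak{g},\mathfrak{h},\phi)$ of two Lie algebras and a Lie algebra homomorphism $\phi:\mathfrak{g}\to\mathfrak{h}$. A morphism Lie subalgebra is a triple $(\mathfrak{p},\mathfrak{q},\varphi)$ with $\mathfrak{p}\subset\mathfrak{g}$, $\mathfrak{q}\subset\mathfrak{h}$ Lie subalgebras and $\varphi:\mathfrak{p}\to\mathfrak{q}$ a linear map with $\varphi=\phi|_{\mathfrak{p}}$ (so $\phi(\mathfrak{p})\subset\mathfrak{q}$). Cohomology. $\mathfrak{g}/\mathfrak{p}$ is a representation of $\mathfrak{p}$ by $p\cdot(x\bmod\mathfrak{p})=[p,x]_{\mathfrak{g}}\bmod\mathfrak{p}$; $\mathfrak{h}/\mathfrak{q}$ is a representation of $\mathfrak{q}$ by $q\cdot(h\bmod\mathfrak{q})=[q,h]_{\mathfrak{h}}\bmod\mathfrak{q}$, hence also of $\mathfrak{p}$ via $\varphi$. Let $\phi/\varphi:\mathfrak{g}/\mathfrak{p}\to\mathfrak{h}/\mathfrak{q}$ be the map induced by $\phi$. For a representation $(V,\rho)$ of a Lie algebra, the Chevalley–Eilenberg differential is $(\delta_{\mathsf{CE}}f)(x_1,\ldots,x_{n+1})=\sum_i(-1)^{i+1}\rho(x_i)f(\ldots,\widehat{x_i},\ldots)+\sum_{i<j}(-1)^{i+j}f([x_i,x_j],\ldots,\widehat{x_i},\ldots,\widehat{x_j},\ldots)$. Let $\delta'_{\mathsf{CE}},\delta''_{\mathsf{CE}},\delta'''_{\mathsf{CE}}$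 be the differentials for $\mathfrak{p}$ with values in $\mathfrak{g}/\mathfrak{p}$, $\mathfrak{q}$ with values in $\mathfrak{h}/\mathfrak{q}$, and $\mathfrak{p}$ with values in $\mathfrak{h}/\mathfrak{q}$. The complex $C^*_{\mathsf{mLA}}(\varphi,\phi/\varphi)$ is $C^0_{\mathsf{mLA}}=\mathfrak{g}/\mathfrak{p}$, $C^n_{\mathsf{mLA}}=\mathrm{Hom}(\wedge^n\mathfrak{p},\mathfrak{g}/\mathfrak{p})\oplus\mathrm{Hom}(\wedge^n\mathfrak{q},\mathfrak{h}/\mathfrak{q})\oplus\mathrm{Hom}(\wedge^{n-1}\mathfrak{p},\mathfrak{h}/\mathfrak{q})$ for $n\ge1$, with $\delta_{\mathsf{mLA}}(v)=(\delta'_{\mathsf{CE}}v,\delta''_{\mathsf{CE}}((\phi/\varphi)(v)),0)$ for $v\in\mathfrak{g}/\mathfrak{p}$ and $\delta_{\mathsf{mLA}}(\theta,\gamma,\eta)=(\delta'_{\mathsf{CE}}\theta,\delta''_{\mathsf{CE}}\gamma,(\phi/\varphi)\circ\theta-\gamma\circ\wedge^n\varphi-\delta'''_{\mathsf{CE}}\eta)$ for $n\ge1$. $Z^n_{\mathsf{mLA}}$ and $H^n_{\mathsf{mLA}}$ denote its cocycles and cohomology. Deformations. Let $d=\dim\mathfrak{p}$, $l=\dim\mathfrak{q}$, and let $\mathrm{Gr}_d(\mathfrak{g})$, $\mathrm{Gr}_l(\mathfrak{h})$ be the Grassmannians of $d$-dimensional subspaces of $\mathfrak{g}$ and $l$-dimensional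 subspaces of $\mathfrak{h}$. A deformation of $(\mathfrak{p},\mathfrak{q},\phi|_{\mathfrak{p}})$ is a pair of smooth curves $\mathfrak{p}_t\in C^\infty([0,1],\mathrm{Gr}_d(\mathfrak{g}))$, $\mathfrak{q}_t\in C^\infty([0,1],\mathrm{Gr}_l(\mathfrak{h}))$ such that for all $t$: (i) $\mathfrak{p}_t$ is a Lie subalgebra of $\mathfrak{g}$, with $\mathfrak{p}_0=\mathfrak{p}$; (ii) $\mathfrak{q}_t$ is a Lie subalgebra of $\mathfrak{h}$, with $\mathfrak{q}_0=\mathfrak{q}$; (iii) $\phi(\mathfrak{p}_t)\subset\mathfrak{q}_t$ and $\phi|_{\mathfrak{p}_t}:\mathfrak{p}_t\to\mathfrak{q}_t$ is a Lie algebra homomorphism. The tangent vector $\dot{\mathfrak{p}}_0=\frac{d}{dt}|_{t=0}\mathfrak{p}_t\in T_{\mathfrak{p}}\mathrm{Gr}_d(\mathfrak{g})$ is identified with the element of $\mathrm{Hom}(\mathfrak{p},\mathfrak{g}/\mathfrak{p})$ given by $\dot{\mathfrak{p}}_0(p)=\frac{d}{dt}|_{t=0}a_t(p)\bmod\mathfrak{p}$, where $a_t$ is any smooth curve in $\mathrm{GL}(\mathfrak{g})$ starting at the identity with $\mathfrak{p}_t=a_t(\mathfrak{p})$; $\dot{\mathfrak{q}}_0\in\mathrm{Hom}(\mathfrak{q},\mathfrak{h}/\mathfrak{q})$ is defined in the same way from $\mathfrak{q}_t$. Let $G,H$ be the simply connected Lie groups integrating $\mathfrak{g},\mathfrak{h}$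 and $\Phi:G\to H$ the Lie group homomorphism integrating $\phi$. Two deformations $(\mathfrak{p}_t,\mathfrak{q}_t)$ and $(\mathfrak{p}'_t,\mathfrak{q}'_t)$ are equivalent if there is a smooth curve $g_t$ in $G$ starting at $1_G$ such that $\mathfrak{p}'_t=\mathrm{Ad}^G_{g_t}\mathfrak{p}_t$ and $\mathfrak{q}'_t=\mathrm{Ad}^H_{\Phi(g_t)}\mathfrak{q}_t$. *)

(* Defs.v *)
From HB Require Import structures.
From mathcomp Require Import all_boot all_order all_algebra.
From mathcomp Require Import generic_quotient ring_quotient.
From mathcomp Require Import mathcomp_extra boolp classical_sets functions.
From mathcomp Require Import reals topology normedtype derive.

Set Implicit Arguments.
Unset Strict Implicit.
Unset Printing Implicit Defensive.

Import Order.TTheory GRing.Theory Num.Theory.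
Import numFieldNormedType.Exports.

Local Open Scope classical_set_scope.
Local Open Scope quotient_scope.
Local Open Scope ring_scope.

HB.mixin Record Vector_isLie (K : fieldType) (L : Type) & Vector K L := {
  lie : L -> L -> L;
  lieDl : forall (a : K) (x y z : L),
    lie (a *: x + y) z = a *: lie x z + lie y z;
  lieDr : forall (a : K) (x y z : L),
    lie x (a *: y + z) = a *: lie x y + lie x z;
  liexx : forall x : L, lie x x = 0;
  lie_jacobi : forall x y z : L,
    lie x (lie y z) + lie y (lie z x) + lie z (lie x y) = 0 }.

#[short(type="lieAlgType")]
HB.structure Definition LieAlg (K : fieldType) :=
  {L of Vector K L & Vector_isLie K L}.

Definition is_lie_morphism (K : fieldType) (g h : lieAlgType K)
    (phi : 'Hom(g, h)) : Prop :=
  forall x y : g, phi (lie x y) = lie (phi x) (phi y).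

Definition is_lie_subalgebra (K : fieldType) (g : lieAlgType K)
    (U : {vspace g}) : Prop :=
  forall x y : g, x \in U -> y \in U -> lie x y \in U.

Record lieSubalg (K : fieldType) (g : lieAlgType K) := LieSubalg {
  lieSubalg_space :> {vspace g};
  lieSubalgP : is_lie_subalgebra lieSubalg_space }.

Definition subvs_lie (K : fieldType) (g : lieAlgType K) (p : lieSubalg g)
    (x y : subvs_of p) : subvs_of p :=
  vsproj p (lie (vsval x) (vsval y)).

Lemma vsval_subvs_lie (K : fieldType) (g : lieAlgType K) (p : lieSubalg g)
    (x y : subvs_of p) : vsval (subvs_lie x y) = lie (vsval x) (vsval y).
Proof. by rewrite vsprojK // (@lieSubalgP _ _ p) ?subvsP. Qed.

Lemma subvs_lieDl (K : fieldType) (g : lieAlgType K) (p : lieSubalg g)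
    (a : K) (x y z : subvs_of p) :
  subvs_lie (a *: x + y) z = a *: subvs_lie x z + subvs_lie y z.
Proof.
by apply: subvs_inj; rewrite linearP /= !vsval_subvs_lie linearP lieDl.
Qed.

Lemma subvs_lieDr (K : fieldType) (g : lieAlgType K) (p : lieSubalg g)
    (a : K) (x y z : subvs_of p) :
  subvs_lie x (a *: y + z) = a *: subvs_lie x y + subvs_lie x z.
Proof.
by apply: subvs_inj; rewrite linearP /= !vsval_subvs_lie linearP lieDr.
Qed.

Lemma subvs_liexx (K : fieldType) (g : lieAlgType K) (p : lieSubalg g)
    (x : subvs_of p) : subvs_lie x x = 0.
Proof. by apply: subvs_inj; rewrite vsval_subvs_lie liexx linear0. Qed.

Lemma subvs_lie_jacobi (K : fieldType) (g : lieAlgType K) (p : lieSubalg g)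
    (x y z : subvs_of p) :
  subvs_lie x (subvs_lie y z) + subvs_lie y (subvs_lie z x)
    + subvs_lie z (subvs_lie x y) = 0.
Proof.
by apply: subvs_inj; rewrite !linearD linear0 /= !vsval_subvs_lie lie_jacobi.
Qed.

HB.instance Definition _ (K : fieldType) (g : lieAlgType K)
    (p : lieSubalg g) :=
  Vector_isLie.Build K (subvs_of p) (@subvs_lieDl K g p) (@subvs_lieDr K g p)
    (@subvs_liexx K g p) (@subvs_lie_jacobi K g p).

Definition quotv (K : fieldType) (V : vectType K) (U : {vspace V}) : Type :=
  Quotient.quot (pred_of_vspace U).

HB.instance Definition _ (K : fieldType) (V : vectType K) (U : {vspace V}) :=
  GRing.Zmodule.on (quotv U).
HB.instance Definition _ (K : fieldType) (V : vectType K) (U : {vspace V}) :=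
  ZmodQuotient.on (quotv U).

Definition quotv_pi (K : fieldType) (V : vectType K) (U : {vspace V})
    (x : V) : quotv U :=
  \pi_(quotv U) x.

Definition quotv_scale (K : fieldType) (V : vectType K) (U : {vspace V})
    (a : K) (x : quotv U) : quotv U :=
  quotv_pi U (a *: repr x).

Lemma quotv_piK (K : fieldType) (V : vectType K) (U : {vspace V})
    (x : quotv U) : quotv_pi U (repr x) = x.
Proof. exact: reprK. Qed.

Lemma quotv_piD (K : fieldType) (V : vectType K) (U : {vspace V}) (x y : V) :
  quotv_pi U (x + y) = quotv_pi U x + quotv_pi U y.
Proof. exact: pi_addr. Qed.

Lemma quotv_piP (K : fieldType) (V : vectType K) (U : {vspace V}) (x y : V) :
  (quotv_pi U x = quotv_pi U y) <-> (x - y \in U).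
Proof.
rewrite /quotv_pi; split => [/eqP|h]; first by rewrite piE.
by apply/eqP; rewrite piE.
Qed.

Lemma quotv_piZ (K : fieldType) (V : vectType K) (U : {vspace V})
    (a : K) (x : V) : quotv_pi U (a *: x) = quotv_scale a (quotv_pi U x).
Proof.
by apply/quotv_piP; rewrite -scalerBr memvZ // -quotv_piP quotv_piK.
Qed.

Lemma quotv_scaleA (K : fieldType) (V : vectType K) (U : {vspace V})
    (a b : K) (x : quotv U) :
  quotv_scale a (quotv_scale b x) = quotv_scale (a * b) x.
Proof. by rewrite -(quotv_piK x) -!quotv_piZ scalerA. Qed.

Lemma quotv_scale1 (K : fieldType) (V : vectType K) (U : {vspace V}) :
  left_id 1 (@quotv_scale K V U).
Proof. by move=> x; rewrite -(quotv_piK x) -quotv_piZ scale1r. Qed.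

Lemma quotv_scaleDr (K : fieldType) (V : vectType K) (U : {vspace V}) :
  right_distributive (@quotv_scale K V U) +%R.
Proof.
move=> a x y; rewrite -(quotv_piK x) -(quotv_piK y).
by rewrite -quotv_piD -!quotv_piZ scalerDr quotv_piD.
Qed.

Lemma quotv_scaleDl (K : fieldType) (V : vectType K) (U : {vspace V})
    (x : quotv U) : {morph (@quotv_scale K V U)^~ x : a b / a + b}.
Proof.
by move=> a b /=; rewrite -(quotv_piK x) -!quotv_piZ scalerDl quotv_piD.
Qed.

HB.instance Definition _ (K : fieldType) (V : vectType K) (U : {vspace V}) :=
  GRing.Zmodule_isLmodule.Build K (quotv U) (@quotv_scaleA K V U)
    (@quotv_scale1 K V U) (@quotv_scaleDr K V U) (@quotv_scaleDl K V U).

Definition slot_set (n : nat) (T : Type) (x : 'I_n -> T) (i : 'I_n) (u : T) :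
    'I_n -> T :=
  fun k => if k == i then u else x k.

(* Hom(/\^n P, V) is the space of alternating multilinear maps P^n -> V. *)
Definition alternating_multilinear (K : fieldType) (n : nat)
    (P V : lmodType K) (f : ('I_n -> P) -> V) : Prop :=
  (forall (x : 'I_n -> P) (i : 'I_n) (a : K) (u v : P),
     f (slot_set x i (a *: u + v))
     = a *: f (slot_set x i u) + f (slot_set x i v)) /\
  (forall (x : 'I_n -> P) (i j : 'I_n), i != j -> x i = x j -> f x = 0).

(* (b, x_0, .., x_n) with x_i and x_j omitted, for i < j: skipping first i,
   then j, is right because i < j, and then [inord] never overflows. *)
Definition bracket_slots (n : nat) (T : Type) (x : 'I_n.+1 -> T)
    (i j : 'I_n.+1) (b : T) : 'I_n -> T :=
  fun k => if val k == 0%N then b else x (inord (bump j (bump i k.-1))).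

(* Indices start at 0 here, so the sign (-1)^{i+1} of the first sum becomes
   (-1)^i, and that of the second sum is unchanged. *)
Definition ce_diff (K : fieldType) (P : lieAlgType K) (V : lmodType K)
    (rho : P -> V -> V) (n : nat) (f : ('I_n -> P) -> V) :
    ('I_n.+1 -> P) -> V :=
  fun x =>
    \sum_(i < n.+1) (-1) ^+ i *: rho (x i) (f (fun k => x (lift i k)))
    + \sum_(i < n.+1) \sum_(j < n.+1 | (i < j)%N)
        (-1) ^+ (i + j) *: f (bracket_slots x i j (lie (x i) (x j))).

(* Coefficients: a morphism [psi : P -> Q], a representation [V] of [P], a
   representation [W] of [Q], and a map [f : V -> W]. *)
Record mla_data (K : fieldType) := MlaData {
  mla_P : lieAlgType K;
  mla_Q : lieAlgType K;
  mla_psi : mla_P -> mla_Q;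
  mla_V : lmodType K;
  mla_W : lmodType K;
  mla_rhoV : mla_P -> mla_V -> mla_V;
  mla_rhoW : mla_Q -> mla_W -> mla_W;
  mla_f : mla_V -> mla_W }.

Definition mla_ambient (K : fieldType) (D : mla_data K) (n : nat) : lmodType K :=
  match n with
  | 0 => mla_V D
  | m.+1 => ((('I_m.+1 -> mla_P D) -> mla_V D)
             * (('I_m.+1 -> mla_Q D) -> mla_W D)
             * (('I_m -> mla_P D) -> mla_W D))%type
  end.

Definition mla_cochain (K : fieldType) (D : mla_data K) (n : nat) :
    set (mla_ambient D n) :=
  match n return set (mla_ambient D n) with
  | 0 => setT
  | m.+1 => [set c | [/\ alternating_multilinear c.1.1,
                         alternating_multilinear c.1.2
                       & alternating_multilinear c.2]]
  end.

Definition mla_diff (K : fieldType) (D : mla_data K) (n : nat) :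
    mla_ambient D n -> mla_ambient D n.+1 :=
  match n return mla_ambient D n -> mla_ambient D n.+1 with
  | 0 => fun v =>
      (ce_diff (@mla_rhoV K D) (fun _ : 'I_0 -> mla_P D => v),
       ce_diff (@mla_rhoW K D) (fun _ : 'I_0 -> mla_Q D => mla_f v),
       0)
  | m.+1 => fun c =>
      (ce_diff (@mla_rhoV K D) c.1.1,
       ce_diff (@mla_rhoW K D) c.1.2,
       fun x : 'I_m.+1 -> mla_P D =>
         mla_f (c.1.1 x) - c.1.2 (fun k => mla_psi (x k))
         - ce_diff (fun y : mla_P D => mla_rhoW (mla_psi y)) c.2 x)
  end.

Definition mla_cocycle (K : fieldType) (D : mla_data K) (n : nat) :
    set (mla_ambient D n) :=
  [set c | mla_cochain c /\ mla_diff c = 0].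

Definition mla_coboundary (K : fieldType) (D : mla_data K) (n : nat) :
    set (mla_ambient D n) :=
  match n return set (mla_ambient D n) with
  | 0 => [set 0]
  | m.+1 => @mla_diff K D m @` @mla_cochain K D m
  end.

(* The element of H^n = Z^n / B^n represented by [c], as a coset. *)
Definition mla_class (K : fieldType) (D : mla_data K) (n : nat)
    (c : mla_ambient D n) : set (mla_ambient D n) :=
  [set c' | mla_cocycle c' /\ mla_coboundary (c' - c)].

Definition quot_rep (K : fieldType) (g : lieAlgType K) (p : lieSubalg g)
    (x : subvs_of p) (v : quotv p) : quotv p :=
  quotv_pi p (lie (vsval x) (repr v)).

Definition quot_map (K : fieldType) (g h : lieAlgType K) (phi : 'Hom(g, h))
    (p : lieSubalg g) (q : lieSubalg h) (v : quotv p) : quotv q :=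
  quotv_pi q (phi (repr v)).

Definition restr (K : fieldType) (g h : lieAlgType K) (phi : 'Hom(g, h))
    (p : lieSubalg g) (q : lieSubalg h) (x : subvs_of p) : subvs_of q :=
  vsproj q (phi (vsval x)).

Definition sub_mla_data (K : fieldType) (g h : lieAlgType K)
    (phi : 'Hom(g, h)) (p : lieSubalg g) (q : lieSubalg h) : mla_data K :=
  @MlaData K (subvs_of p) (subvs_of q) (@restr K g h phi p q)
    (quotv p) (quotv q) (@quot_rep K g p) (@quot_rep K h q)
    (@quot_map K g h phi p q).

Fixpoint Ck_on (R : realType) (V W : normedModType R) (k : nat) (U : set V)
    (f : V -> W) : Prop :=
  match k with
  | 0 => forall x, U x -> {for x, continuous f}
  | k'.+1 => (forall x, U x -> differentiable f x) /\
             (forall v : V, Ck_on k' U (fun x => 'd f x v))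
  end.

(* [U] is meant to be open. *)
Definition smooth_on (R : realType) (V W : normedModType R) (U : set V)
    (f : V -> W) : Prop :=
  forall k, Ck_on k U f.

(* A [vectType] carries no topology in the library: smoothness and derivatives
   of curves in V are those of their coordinates in a basis. *)
Definition coords (R : realType) (V : vectType R) (v : V) :
    'rV[R]_(\dim {:V}) :=
  passmx.rVof (vbasis {:V}) v.

Definition of_coords (R : realType) (V : vectType R)
    (x : 'rV[R]_(\dim {:V})) : V :=
  passmx.vecof (vbasis {:V}) x.

Definition smooth_curve (R : realType) (V : vectType R) (f : R -> V) : Prop :=
  smooth_on [set: R] (fun t : R => coords (f t)).

Definition curve_deriv (R : realType) (V : vectType R) (f : R -> V) (t : R) :
    V :=
  of_coords (derive1 (fun s : R => coords (f s)) t).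

Definition graph_space (R : realType) (V : vectType R) (W C : {vspace V})
    (A : 'Hom(subvs_of W, subvs_of C)) : {vspace V} :=
  limg (linfun (fun w : subvs_of W => vsval w + vsval (A w))).

(* The graphs of the elements of Hom(W, C), for W of dimension d and C a
   complement of W, form a chart domain of the Grassmannian; a curve on [0, 1]
   is smooth when, near each point, it is given in a chart by the restriction
   of a smooth curve R -> Hom(W, C). *)
Definition smooth_grassmannian_curve (R : realType) (V : vectType R) (d : nat)
    (pt : R -> {vspace V}) : Prop :=
  forall t0 : R, 0 <= t0 <= 1 ->
  exists (W C : {vspace V}) (A : R -> 'Hom(subvs_of W, subvs_of C)) (e : R),
    [/\ \dim W = d, (W + C)%VS = fullv, (W :&: C)%VS = 0%VS,
        smooth_curve A & 0 < e] /\
    forall t : R, 0 <= t <= 1 -> `|t - t0| < e -> pt t = graph_space (A t).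

(* Only the germ at 0 of the curve [a] in GL(V) matters, so [a] is required to
   be invertible and to move [p] to [pt t] near 0 only; [a] itself is a smooth
   extension to R, so its derivative at 0 is the one-sided derivative of its
   restriction to t >= 0. *)
Definition is_velocity0 (R : realType) (V : vectType R) (p : {vspace V})
    (pt : R -> {vspace V}) (theta : subvs_of p -> quotv p) : Prop :=
  exists (a : R -> 'End(V)) (e : R),
    [/\ 0 < e, smooth_curve a, a 0 = \1%VF,
        (forall t : R, 0 <= t <= 1 -> t < e ->
           lker (a t) = 0%VS /\ pt t = (a t @: p)%VS)
      & forall x : subvs_of p,
          theta x = quotv_pi p (curve_deriv (fun t => a t (vsval x)) 0)].

(* The element of Hom(p, V/p) identified with the tangent vector at 0. A smooth
   curve starting at [p] has exactly one velocity, so the default value 0 is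
   not reached on such curves. *)
Definition velocity0 (R : realType) (V : vectType R) (p : {vspace V})
    (pt : R -> {vspace V}) : subvs_of p -> quotv p :=
  xget (fun=> 0) [set theta | is_velocity0 pt theta].

Record chart (R : realType) (M : topologicalType) (n : nat) := Chart {
  chart_dom : set M;
  chart_map :> M -> 'rV[R]_n;
  chart_inv : 'rV[R]_n -> M;
  chart_dom_open : open chart_dom;
  chart_img_open : open (chart_map @` chart_dom);
  chart_invK : forall x, chart_dom x -> chart_inv (chart_map x) = x;
  chart_continuous : {within chart_dom, continuous chart_map};
  chart_inv_continuous :
    {within chart_map @` chart_dom, continuous chart_inv} }.

Record manifold (R : realType) (n : nat) := Manifold {
  manifold_space :> topologicalType;
  atlas : set (chart R manifold_space n);
  atlas_cover : forall x, exists2 a, atlas a & chart_dom a x;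
  atlas_compatible : forall a b, atlas a -> atlas b ->
    smooth_on (a @` (chart_dom a `&` chart_dom b)) (b \o chart_inv a);
  manifold_hausdorff : hausdorff_space manifold_space;
  manifold_second_countable : @second_countable manifold_space }.

Definition smooth_map (R : realType) (m n : nat) (M : manifold R m)
    (N : manifold R n) (F : M -> N) : Prop :=
  continuous F /\
  forall a b, atlas a -> atlas b ->
    smooth_on (a @` (chart_dom a `&` F @^-1` chart_dom b))
      (b \o F \o chart_inv a).

(* The charts of the product manifold M x N are the products of charts. *)
Definition smooth_map2 (R : realType) (m n l : nat) (M : manifold R m)
    (N : manifold R n) (L : manifold R l) (F : M * N -> L) : Prop :=
  continuous F /\
  forall a b c, atlas a -> atlas b -> atlas c ->
    smooth_on
      ((fun z : M * N => (a z.1, b z.2)) @`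
         ((chart_dom a `*` chart_dom b) `&` F @^-1` chart_dom c))
      (fun u : 'rV[R]_m * 'rV[R]_n => c (F (chart_inv a u.1, chart_inv b u.2))).

Record lieGroup (R : realType) (n : nat) := LieGroup {
  lg_manifold :> manifold R n;
  lg_one : lg_manifold;
  lg_mul : lg_manifold -> lg_manifold -> lg_manifold;
  lg_inv : lg_manifold -> lg_manifold;
  lg_mulA : associative lg_mul;
  lg_mul1 : left_id lg_one lg_mul;
  lg_mulV : left_inverse lg_one lg_inv lg_mul;
  lg_mul_smooth :
    smooth_map2 (fun z : lg_manifold * lg_manifold => lg_mul z.1 z.2);
  lg_inv_smooth : smooth_map lg_inv }.

Definition simply_connected (R : realType) (X : topologicalType) : Prop :=
  (forall x y : X, exists c : R -> X,
     [/\ {within `[0, 1], continuous c}, c 0 = x & c 1 = y]) /\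
  (forall c : R -> X, {within `[0, 1], continuous c} -> c 0 = c 1 ->
   exists F : R * R -> X,
     [/\ {within `[0, 1] `*` `[0, 1], continuous F},
         (forall s : R, 0 <= s <= 1 -> F (s, 0) = c s),
         (forall s : R, 0 <= s <= 1 -> F (s, 1) = c 0)
       & forall t : R, 0 <= t <= 1 -> F (0, t) = c 0 /\ F (1, t) = c 0]).

(* A linear isomorphism of the tangent space of [G] at the identity with [V];
   the tangent space is read in the chart [tf_chart]. *)
Record tangent_frame (R : realType) (n : nat) (G : lieGroup R n)
    (V : vectType R) := TangentFrame {
  tf_chart : chart R G n;
  tf_chart_atlas : atlas tf_chart;
  tf_chart_one : chart_dom tf_chart (lg_one G);
  tf_iso : 'Hom('rV[R]_n, V);
  tf_iso_inj : lker tf_iso = 0%VS;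
  tf_iso_surj : limg tf_iso = fullv }.

(* The differential at 1 of [F : G -> N], read in the chart at 1 of [G]. *)
Definition tf_diff1 (R : realType) (n : nat) (G : lieGroup R n)
    (V : vectType R) (TG : tangent_frame G V) (N : normedModType R)
    (F : G -> N) (u : V) : N :=
  'd (F \o chart_inv (tf_chart TG)) (tf_chart TG (lg_one G))
     ((tf_iso TG)^-1%VF u).

(* Ad_x is the differential at 1 of y |-> x y x^-1. *)
Definition Ad (R : realType) (n : nat) (G : lieGroup R n) (V : vectType R)
    (TG : tangent_frame G V) (x : G) : 'End(V) :=
  linfun (fun u : V =>
    tf_iso TG (tf_diff1 TG
      (fun y : G => tf_chart TG (lg_mul (lg_mul x y) (lg_inv x))) u)).

(* [g] is the Lie algebra of [G], i.e. [u, v] = ad_u v where ad is the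
   differential of Ad at 1. *)
Definition integrates (R : realType) (n : nat) (G : lieGroup R n)
    (g : lieAlgType R) (TG : tangent_frame G g) : Prop :=
  forall u v : g,
    lie u v
    = of_coords (tf_diff1 TG (fun x : G => coords (Ad TG x v)) u).

Definition integrates_morphism (R : realType) (m n : nat) (G : lieGroup R m)
    (H : lieGroup R n) (g h : lieAlgType R) (TG : tangent_frame G g)
    (TH : tangent_frame H h) (phi : 'Hom(g, h)) (Phi : G -> H) : Prop :=
  [/\ smooth_map Phi,
      {morph Phi : x y / lg_mul x y >-> lg_mul x y}
    & forall u : g,
        phi u = tf_iso TH (tf_diff1 TG (fun x : G => tf_chart TH (Phi x)) u)].

(* Smooth on [0, 1]: near each of its points, the curve is, in a chart, the
   restriction of a smooth curve defined on R. *)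
Definition smooth_manifold_curve (R : realType) (n : nat) (M : manifold R n)
    (c : R -> M) : Prop :=
  forall t0 : R, 0 <= t0 <= 1 ->
  exists (a : chart R M n) (f : R -> 'rV[R]_n) (e : R),
    [/\ atlas a, smooth_on [set: R] f & 0 < e] /\
    forall t : R, 0 <= t <= 1 -> `|t - t0| < e ->
      chart_dom a (c t) /\ a (c t) = f t.

Definition is_deformation (R : realType) (g h : lieAlgType R)
    (phi : 'Hom(g, h)) (p : lieSubalg g) (q : lieSubalg h)
    (pt : R -> {vspace g}) (qt : R -> {vspace h}) : Prop :=
  [/\ smooth_grassmannian_curve (\dim p) pt,
      smooth_grassmannian_curve (\dim q) qt,
      pt 0 = p, qt 0 = q
    & forall t : R, 0 <= t <= 1 ->
      [/\ is_lie_subalgebra (pt t), is_lie_subalgebra (qt t),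
          (phi @: pt t <= qt t)%VS
        & forall x y : g, x \in pt t -> y \in pt t ->
            phi (lie x y) = lie (phi x) (phi y)]].

Definition equivalent_deformations (R : realType) (m n : nat)
    (G : lieGroup R m) (H : lieGroup R n) (g h : lieAlgType R)
    (TG : tangent_frame G g) (TH : tangent_frame H h) (Phi : G -> H)
    (pt : R -> {vspace g}) (qt : R -> {vspace h})
    (pt' : R -> {vspace g}) (qt' : R -> {vspace h}) : Prop :=
  exists c : R -> G,
    [/\ smooth_manifold_curve c, c 0 = lg_one G
      & forall t : R, 0 <= t <= 1 ->
          pt' t = (Ad TG (c t) @: pt t)%VS /\
          qt' t = (Ad TH (Phi (c t)) @: qt t)%VS].

Definition deformation_cochain (R : realType) (g h : lieAlgType R)
    (phi : 'Hom(g, h)) (p : lieSubalg g) (q : lieSubalg h)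
    (pt : R -> {vspace g}) (qt : R -> {vspace h}) :
    mla_ambient (sub_mla_data phi p q) 1 :=
  (fun x : 'I_1 -> subvs_of p => velocity0 pt (x ord0),
   fun x : 'I_1 -> subvs_of q => velocity0 qt (x ord0),
   0).

(* Main.v *)
Require Import Defs.
From HB Require Import structures.
From mathcomp Require Import all_boot all_order all_algebra.
From mathcomp Require Import mathcomp_extra boolp classical_sets functions.
From mathcomp Require Import reals topology normedtype landau derive.

Set Implicit Arguments.
Unset Strict Implicit.
Unset Printing Implicit Defensive.

Import Order.TTheory GRing.Theory Num.Theory.
Import numFieldNormedType.Exports.

Local Open Scope classical_set_scope.
Local Open Scope ring_scope.

(* Every curve f with f t in pt t and f 0 = x in p represents the velocity at
   x: f'(0) mod p depends on x only, because in a Grassmannian chart pt t is the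
   kernel of a smooth family of linear maps. Applied to a bracket [f t, k t] of
   two such curves, and to phi (f t), this gives the cocycle equations. Applied
   to Ad_(c t) (f t), whose derivative is [u, x] + f'(0) for u = c'(0), it shows
   that equivalent deformations have cochains differing by the coboundary of
   u mod p. That Ad is differentiable at 1 follows from the chain rule: near 1,
   in a chart where m and i are the multiplication and the inversion,
   Ad_y w = d_1 m(y, i y) (d_2 m(y, 1) w). *)

(** * Derivatives at 0 in coordinates *)

(** Stated coordinate by coordinate and as a relation, so that the rules for scalar [is_derive]
    apply directly and each rule also delivers the value of the derivative. *)
Definition vderive0 (R : realType) (V : vectType R) (f : R -> V) (v : V) :=
  forall i, is_derive (0 : R) (1 : R) (fun t => coords (f t) 0 i) (coords v 0 i).

Lemma coordsK (R : realType) (V : vectType R) :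
  cancel (@coords R V) (@of_coords R V).
Proof. by apply: passmx.rVofK; exact: vbasisP. Qed.

Lemma of_coordsK (R : realType) (V : vectType R) :
  cancel (@of_coords R V) (@coords R V).
Proof. by apply: passmx.vecofK; exact: vbasisP. Qed.

Lemma coords_linear (R : realType) (V : vectType R) : linear (@coords R V).
Proof. exact: passmx.rVof_linear. Qed.

HB.instance Definition _ (R : realType) (V : vectType R) :=
  GRing.isLinear.Build R V 'rV[R]_(\dim {:V}) _ (@coords R V) (@coords_linear R V).

Lemma coords0E (R : realType) (V : vectType R) i : coords (0 : V) 0 i = 0.
Proof. by rewrite linear0 mxE. Qed.

Lemma coordsDE (R : realType) (V : vectType R) (u v : V) i :
  coords (u + v) 0 i = coords u 0 i + coords v 0 i.
Proof. by rewrite linearD mxE. Qed.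

Lemma coordsBE (R : realType) (V : vectType R) (u v : V) i :
  coords (u - v) 0 i = coords u 0 i - coords v 0 i.
Proof. by rewrite linearB !mxE. Qed.

Lemma coords_sum (R : realType) (V : vectType R) (v : V) :
  v = \sum_j coords v 0 j *: (vbasis {:V})`_j.
Proof. by rewrite -[LHS]coordsK. Qed.

Lemma coords_app (R : realType) (V W : vectType R) (f : V -> W) v i :
  linear f ->
  coords (f v) 0 i = \sum_j coords v 0 j * coords (f (vbasis {:V})`_j) 0 i.
Proof.
move=> lf; pose fL : {linear V -> W} :=
  HB.pack f (GRing.isLinear.Build _ _ _ _ f lf).
have fE u : f u = linfun fL u by rewrite lfunE.
rewrite fE {1}(coords_sum v) !linear_sum /= summxE.
by apply: eq_bigr => j _; rewrite fE !linearZ mxE.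
Qed.

(** Product rule for a moving linear map at a moving vector. Expanding [x t] in the basis gives sums
    of products of scalar functions, so [L] need only be differentiated at fixed vectors. The rule
    serves for brackets, Grassmannian charts and [Ad] alike. *)
Lemma vderive0_app (R : realType) (V W : vectType R) (L : R -> V -> W)
    (D : V -> W) (x : R -> V) (x' : V) :
  (forall t, linear (L t)) -> linear D ->
  (forall v, vderive0 (L^~ v) (D v)) -> vderive0 x x' ->
  vderive0 (fun t => L t (x t)) (D (x 0) + L 0 x').
Proof.
move=> lL lD dL dx i; rewrite coordsDE !coords_app // -big_split /=.
under eq_fun do rewrite coords_app //.
pose h j t := coords (x t) 0 j * coords (L t (vbasis {:V})`_j) 0 i.
rewrite (_ : (fun t => _) = \sum_j h j); last first.
  by apply/funext => t; rewrite fct_sumE.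
apply: is_derive_sum => j; have := dx j; have := dL (vbasis {:V})`_j i => d1 d2.
by rewrite [X in _ + X]mulrC; exact: (is_deriveM d2 d1).
Qed.

Lemma vderive0_cst (R : realType) (V : vectType R) (v : V) : vderive0 (fun=> v) 0.
Proof. by move=> i; rewrite coords0E; exact: is_derive_cst. Qed.

Section VDerive.
Variables (R : realType) (V W : vectType R).

Lemma vderive0_lin (f : V -> W) (x : R -> V) x' :
  linear f -> vderive0 x x' -> vderive0 (fun t => f (x t)) (f x').
Proof.
move=> lf dx; rewrite -[f x']add0r.
apply: (@vderive0_app R V W (fun=> f) (fun=> 0)) => // [a u v|v].
  by rewrite scaler0 addr0.
exact: vderive0_cst.
Qed.

Lemma vderive0B (x y : R -> V) x' y' :
  vderive0 x x' -> vderive0 y y' -> vderive0 (fun t => x t - y t) (x' - y').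
Proof.
move=> dx dy i; rewrite coordsBE.
under eq_fun do rewrite coordsBE.
exact: is_deriveB.
Qed.

Lemma vderive0D (x y : R -> V) x' y' :
  vderive0 x x' -> vderive0 y y' -> vderive0 (fun t => x t + y t) (x' + y').
Proof.
move=> dx dy i; rewrite coordsDE.
under eq_fun do rewrite coordsDE.
exact: is_deriveD.
Qed.

(** The derivative equals the limit of the difference quotients from the right, where they vanish. A
    deformation constrains curves only for [t >= 0], hence the one-sided form. *)
Lemma right_derive_eq0 (f : R -> R) (a e : R) : 0 < e ->
  is_derive (0 : R) (1 : R) f a -> (forall t, 0 <= t < e -> f t = 0) -> a = 0.
Proof.
move=> e0 [df <-] f0; rewrite /derive cvg_at_rightE //.
apply/lim_near_cst => //.
near=> t.
rewrite /= !addr0 !f0 ?subrr ?scaler0 ?lexx ?e0 //.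
rewrite /GRing.scale /= mulr1; apply/andP; split.
  by apply: ltW; near: t; exact: nbhs_right_gt.
by near: t; exact: nbhs_right_lt.
Unshelve. all: by end_near. Qed.

Lemma vderive0_right_unique (x y : R -> V) x' y' e : 0 < e ->
  vderive0 x x' -> vderive0 y y' -> (forall t, 0 <= t < e -> x t = y t) ->
  x' = y'.
Proof.
move=> e0 dx dy xy; apply/eqP; rewrite -subr_eq0; apply/eqP.
apply: (can_inj (@coordsK R V)); apply/rowP => i; rewrite coords0E.
apply: (right_derive_eq0 e0 (vderive0B dx dy i)) => t te.
by rewrite xy // subrr coords0E.
Qed.

Lemma derivable_vderive0 (f : R -> V) :
  derivable (fun t => coords (f t)) (0 : R) (1 : R) ->
  vderive0 f (curve_deriv f 0).
Proof.
move=> df i; rewrite /curve_deriv of_coordsK derive1E (derive_mx df) mxE.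
by apply: derivableP; exact: ((derivable_mxP _ _ _).1 df).
Qed.

Lemma smooth_vderive0 (f : R -> V) : smooth_curve f -> vderive0 f (curve_deriv f 0).
Proof.
by move=> /(_ 1)[df _]; apply/derivable_vderive0/diff_derivable/df.
Qed.

End VDerive.

(** * Smoothness of affine images *)

Section Affine.
Variables (R : realType) (m n : nat) (U : normedModType R).

Lemma mulmx_differentiable (M : 'M[R]_(m, n)) (x : 'rV[R]_m) :
  differentiable (fun y : 'rV[R]_m => y *m M) x.
Proof.
rewrite (_ : (fun y => _) =
  \sum_i (fun y : 'rV[R]_m => y 0 i *: row i M)); last first.
  by apply/funext => y; rewrite fct_sumE; exact: mulmx_sum_row.
apply: differentiable_sum => i.
by apply: differentiableZl; exact: differentiable_coord.
Qed.

Lemma is_diff_affine (M : 'M[R]_(m, n)) (c : 'rV[R]_n) (g : U -> 'rV[R]_m) t :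
  differentiable g t ->
  is_diff t (fun s => c + g s *m M) (fun v => 'd g t v *m M).
Proof.
move=> dg; have dgP := differentiableP dg.
have dM : is_diff (g t) (mulmxr M : 'rV_m -> 'rV_n) (mulmxr M).
  apply: DiffDef; first exact: mulmx_differentiable.
  by apply: diff_lin => y; exact/differentiable_continuous/mulmx_differentiable.
have [dcg dcgE] := is_diffD (is_diff_cst c t) (is_diff_comp dgP dM).
by apply: DiffDef => //; rewrite dcgE add0r.
Qed.

(** Induction on [k]: the derivative in direction [v] is ['d f t v *m M], again an affine image but
    with constant 0, so [c] has to be generalized. *)
Lemma Ck_on_affine (M : 'M[R]_(m, n)) k (c : 'rV[R]_n) (f : U -> 'rV[R]_m) :
  Ck_on k setT f -> Ck_on k setT (fun t => c + f t *m M).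
Proof.
elim: k c f => [|k IH] c f /=.
  move=> cf t _; apply: cvgD; first exact: cvg_cst.
  apply: (@continuous_comp _ _ _ f (fun y => y *m M)); first exact: cf.
  exact/differentiable_continuous/mulmx_differentiable.
move=> [df Cf]; have H t := is_diff_affine M c (df t I).
split=> [t _|v]; first by have [] := H t.
rewrite (_ : (fun x => _) = (fun t => 0 + 'd f t v *m M)); last first.
  by apply/funext => t; rewrite add0r (@diff_val _ _ _ _ _ _ _ (H t)).
exact: IH.
Qed.
End Affine.

Lemma smooth_curve_affine (R : realType) (V W : vectType R) (f : V -> W)
    (c : W) (x : R -> V) :
  linear f -> smooth_curve x -> smooth_curve (fun t => c + f (x t)).
Proof.
move=> lf sx k; pose fL : {linear V -> W} :=
  HB.pack f (GRing.isLinear.Build _ _ _ _ f lf).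
rewrite (_ : (fun t => _) = (fun t => coords c + coords (x t) *m
  passmx.mxof (vbasis {:V}) (vbasis {:W}) (linfun fL))).
  exact/Ck_on_affine/sx.
apply/funext => t; rewrite linearD /=; congr (_ + _).
rewrite /coords -passmx.rVof_app; [|exact: vbasisP].
 by rewrite (lfunE fL).
Qed.

(** * Charts of the Grassmannian *)

Section GraphChart.
Variables (R : realType) (V : vectType R) (W C : {vspace V}).
Hypotheses (WC : (W + C)%VS = fullv) (WC0 : (W :&: C)%VS = 0%VS).

(** Extends [A] by 0 along [C], so that a point of the chart becomes an endomorphism of [V]
    depending linearly on it. *)
Definition graph_ext (A : 'Hom(subvs_of W, subvs_of C)) : 'End(V) :=
  (linfun vsval \o A \o linfun (vsproj W) \o daddv_pi W C)%VF.

Lemma graph_extE A v : graph_ext A v = vsval (A (vsproj W (daddv_pi W C v))).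
Proof. by rewrite !comp_lfunE !lfunE. Qed.

Lemma graph_ext_linear : linear graph_ext.
Proof.
move=> a A B; apply/lfunP => v.
by rewrite add_lfunE scale_lfunE !graph_extE add_lfunE scale_lfunE linearP.
Qed.

Lemma graph_ext_linearl v : linear (graph_ext^~ v).
Proof. by move=> a A B; rewrite graph_ext_linear add_lfunE scale_lfunE. Qed.

Let CW0 : (C :&: W)%VS = 0%VS. Proof. by rewrite capvC. Qed.

Let pi_sum v : daddv_pi W C v + daddv_pi C W v = v.
Proof. by rewrite daddv_pi_add // WC memvf. Qed.

Let pi_eq0 v : v \in C -> daddv_pi W C v = 0.
Proof.
move=> vC; have := pi_sum v.
by rewrite (daddv_pi_id CW0 vC) => /(canRL (addrK v)) ->; rewrite subrr.
Qed.

Let pi'_eq0 v : v \in W -> daddv_pi C W v = 0.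
Proof.
move=> vW; have := pi_sum v.
by rewrite (daddv_pi_id WC0 vW) addrC => /(canRL (addrK v)) ->; rewrite subrr.
Qed.

(** Split [v] along [W] and [C]: on the graph, the [C] part is the image under [A] of the [W]
    part. *)
Lemma mem_graph_space A v :
  (v \in graph_space A) = (daddv_pi C W v == graph_ext A v).
Proof.
pose fL := linfun (fun w : subvs_of W => vsval w + vsval (A w)).
have fE w : fL w = vsval w + vsval (A w).
  pose f w := vsval w + vsval (A w).
  have lf : linear f by move=> a u u'; rewrite /f !linearP /= scalerDr addrACA.
  exact: (lfunE (HB.pack f (GRing.isLinear.Build _ _ _ _ f lf) : {linear _ -> _})).
apply/memv_imgP/eqP => [[w _ ->]|vA].
  rewrite -/fL fE graph_extE !linearD /= (pi_eq0 (subvsP (A w))) !linear0 addr0.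
  rewrite (daddv_pi_id WC0 (subvsP w)) vsvalK (daddv_pi_id CW0 (subvsP (A w))).
  by rewrite pi'_eq0 ?add0r // subvsP.
exists (vsproj W (daddv_pi W C v)); first exact: memvf.
by rewrite -/fL fE -graph_extE -vA vsprojK ?memv_pi ?pi_sum.
Qed.

Lemma pi_graph_ext A v : daddv_pi C W (graph_ext A v) = graph_ext A v.
Proof. by rewrite graph_extE (daddv_pi_id CW0) // subvsP. Qed.

(** The image of [graph_ext B] lies in [C], where [graph_ext A] vanishes. Hence [1 + graph_ext A] is
    a shear with inverse [1 - graph_ext A]. *)
Lemma graph_ext_nil A B v : graph_ext A (graph_ext B v) = 0.
Proof. by rewrite [LHS]graph_extE pi_eq0 ?linear0 // graph_extE subvsP. Qed.

Lemma graph_ext_ker A : lker (\1 + graph_ext A)%VF = 0%VS.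
Proof.
apply/eqP; rewrite -subv0; apply/subvP => v.
rewrite memv_ker memv0 add_lfunE id_lfunE.
move=> /eqP v0; have := congr1 (graph_ext A) v0.
rewrite linearD linear0 /= graph_ext_nil addr0 => Av.
by move: v0; rewrite Av addr0 => ->.
Qed.

(** The shear keeps the [W] part [w] of a vector and adds [(B - A) w] to its [C] part. *)
Lemma graph_ext_img A B :
  ((\1 + graph_ext (B - A)) @: graph_space A)%VS = graph_space B.
Proof.
have BA v : graph_ext (B - A) v = graph_ext B v - graph_ext A v.
  by have := graph_ext_linearl v (-1) A B; rewrite !scaleN1r ![- _ + _]addrC.
apply/vspaceP => v; apply/memv_imgP/idP => [[u uA ->]|vB].
  move: uA; rewrite !mem_graph_space add_lfunE id_lfunE => /eqP uA.
  by rewrite !linearD /= graph_ext_nil addr0 pi_graph_ext BA uA addrC subrK.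
(* The preimage comes from the inverse shear. *)
exists (v - graph_ext (B - A) v).
  move: vB; rewrite !mem_graph_space => /eqP vB.
  by rewrite !linearB /= graph_ext_nil subr0 pi_graph_ext BA vB opprB addrC subrK.
by rewrite add_lfunE id_lfunE linearB /= graph_ext_nil subr0 subrK.
Qed.
End GraphChart.

(** * Velocity of a curve of subspaces *)

Section Velocity.
Variables (R : realType) (V : vectType R) (d : nat) (pt : R -> {vspace V}).
Hypothesis pt_smooth : smooth_grassmannian_curve d pt.

Lemma grassmannian_chart0 :
  exists (W C : {vspace V}) (A : R -> 'Hom(subvs_of W, subvs_of C)) (e : R),
    [/\ (W + C)%VS = fullv, (W :&: C)%VS = 0%VS, smooth_curve A, 0 < e
      & forall t, 0 <= t < e -> pt t = graph_space (A t)].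
Proof.
have [|W [C [A [e [[_ WC WC0 sA e0] ptA]]]]] := pt_smooth (t0 := 0).
  by rewrite lexx ler01.
(* Cutting the radius at 1 puts every [t] with [0 <= t < e] in [[0, 1]]. *)
exists W, C, A, (Num.min e 1); split => //; first by rewrite lt_min e0 ltr01.
move=> t /andP[t0]; rewrite lt_min => /andP[te /ltW t1].
by apply: ptA; rewrite ?t0 // subr0 ger0_norm.
Qed.

(* Near 0, pt t is the kernel of pi_C - A_t pi_W. As x starts at 0, the product
   rule for (pi_C - A_t pi_W) (x t) = 0 leaves (pi_C - A_0 pi_W) x' = 0. *)
Lemma vderive0_grassmannian (x : R -> V) x' e : 0 < e ->
  (forall t, 0 <= t < e -> x t \in pt t) -> x 0 = 0 -> vderive0 x x' ->
  x' \in pt 0.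
Proof.
move=> e0 xpt x0 dx.
have [W [C [A [e1 [WC WC0 sA e10 ptA]]]]] := grassmannian_chart0.
rewrite ptA ?lexx // mem_graph_space // -subr_eq0; apply/eqP.
pose L t v := daddv_pi C W v - graph_ext (A t) v.
pose D v := 0 - graph_ext (curve_deriv A 0) v.
have dL v : vderive0 (L^~ v) (D v).
  apply: vderive0B; first exact: vderive0_cst.
  exact: vderive0_lin (graph_ext_linearl v) (smooth_vderive0 sA).
have lL t : linear (L t).
  by move=> a u v; rewrite /L !linearP /= scalerDr addrACA.
have lD : linear D.
  by move=> a u v; rewrite /D !sub0r linearP /= opprD scalerN.
have dLx := vderive0_app lL lD dL dx.
rewrite x0 {1}/D linear0 subrr add0r in dLx.
apply: (vderive0_right_unique (e := Num.min e e1) _ dLx (vderive0_cst 0)).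
  by rewrite lt_min e0.
move=> t; rewrite lt_min => /and3P[t0 te te1]; apply/eqP; rewrite /L subr_eq0.
by rewrite -mem_graph_space // -ptA ?t0 // xpt ?t0.
Qed.

(** The shears from the graph of [A 0] to that of [A t] form a smooth curve in GL(V) starting at the
    identity. By existence, [xget] in [velocity0] does not fall back on its default. *)
Lemma ex_velocity0 (p : {vspace V}) : pt 0 = p ->
  exists theta : subvs_of p -> quotv p, is_velocity0 pt theta.
Proof.
move=> pt0; have [W [C [A [e [WC WC0 sA e0 ptA]]]]] := grassmannian_chart0.
pose a t := (\1 + graph_ext (A t - A 0))%VF.
(* Affine in [A t], hence smooth. *)
have aE t : a t = (\1 - graph_ext (A 0))%VF + graph_ext (A t).
  have := graph_ext_linear (-1) (A 0) (A t).
  by rewrite /a !scaleN1r ![- _ + _]addrC => ->; rewrite addrAC addrA.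
exists (fun x => quotv_pi p (curve_deriv (fun t => a t (vsval x)) 0)), a, e.
split => //.
- rewrite (_ : a = fun t => (\1 - graph_ext (A 0))%VF + graph_ext (A t)).
    exact: smooth_curve_affine (@graph_ext_linear _ _ _ _) sA.
  exact/funext.
- apply/lfunP => v; rewrite add_lfunE subrr graph_extE zero_lfunE linear0.
  by rewrite addr0.
- move=> t /andP[t0 t1] te; rewrite graph_ext_ker // -pt0.
  by rewrite !ptA ?lexx ?t0 // graph_ext_img.
Qed.

Lemma velocity0_frame (p : {vspace V}) : pt 0 = p -> forall x : subvs_of p,
  exists (e : R) (f : R -> V) (f' : V),
    [/\ 0 < e, f 0 = vsval x, vderive0 f f',
        (forall t, 0 <= t < e -> f t \in pt t)
      & velocity0 pt x = quotv_pi p f'].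
Proof.
move=> pt0 x.
have [a [e [e0 sa a0 apt ->]]] : is_velocity0 pt (@velocity0 _ _ p pt).
  exact: (xgetPex _ (ex_velocity0 pt0)).
have da : vderive0 (fun t => a t (vsval x)) (curve_deriv a 0 (vsval x)).
  apply: (@vderive0_lin _ _ _ (fun f : 'End(V) => f (vsval x))).
    by move=> k u v; rewrite add_lfunE scale_lfunE.
  exact: smooth_vderive0.
exists (Num.min e 1), (fun t => a t (vsval x)), (curve_deriv a 0 (vsval x)).
split => //.
- by rewrite lt_min e0 ltr01.
- by rewrite a0 id_lfunE.
- move=> t /andP[t0]; rewrite lt_min => /andP[te /ltW t1].
  by have [|_ ->] := apt t _ te; rewrite ?t0 // memv_img ?subvsP.
(* [is_velocity0] differentiates the curve [a t x], while the witness is the derivative of [a]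
   applied to [x]; both are derivatives of the same curve. *)
- congr quotv_pi; apply: (vderive0_right_unique (e := 1) _ _ da) => //.
  apply: derivable_vderive0; apply/derivable_mxP => i j; rewrite ord1.
  exact: (@ex_derive _ _ _ _ _ _ _ (da j)).
Qed.

(** The difference with the curve from [velocity0_frame] stays in [pt t] and starts at 0, so its
    derivative lies in [p]. Any convenient curve through [x] thus computes the velocity. *)
Lemma velocity0_curve (p : {vspace V}) (x : subvs_of p) f f' e : pt 0 = p ->
  0 < e -> f 0 = vsval x -> vderive0 f f' ->
  (forall t, 0 <= t < e -> f t \in pt t) -> velocity0 pt x = quotv_pi p f'.
Proof.
move=> pt0 e0 f0 df fpt.
have [e1 [g [g' [e10 g0 dg gpt ->]]]] := velocity0_frame pt0 x.
apply/quotv_piP; rewrite -pt0.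
apply: (@vderive0_grassmannian (fun t => g t - f t) _ (Num.min e e1)).
- by rewrite lt_min e0.
- by move=> t; rewrite lt_min => /and3P[t0 te te1]; rewrite memvB ?gpt ?fpt ?t0.
- by rewrite f0 g0 subrr.
- exact: vderive0B.
Qed.

End Velocity.

(** * The cocycle condition *)

Lemma lie_linearl (K : fieldType) (g : lieAlgType K) (y : g) : linear (lie^~ y).
Proof. by move=> a x x'; exact: lieDl. Qed.

Lemma lie_linearr (K : fieldType) (g : lieAlgType K) (x : g) : linear (lie x).
Proof. by move=> a y y'; exact: lieDr. Qed.

Lemma lieC (K : fieldType) (g : lieAlgType K) (x y : g) : lie x y = - lie y x.
Proof.
have D (a b c : g) : lie (a + b) c = lie a c + lie b c.
  by rewrite -[a in LHS]scale1r lieDl scale1r.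
have D' (a b c : g) : lie c (a + b) = lie c a + lie c b.
  by rewrite -[a in LHS]scale1r lieDr scale1r.
apply/eqP; rewrite -addr_eq0; apply/eqP.
by have := liexx (x + y); rewrite D !D' !liexx add0r addr0.
Qed.

Section Quotient.
Variables (K : fieldType) (V : vectType K) (U : {vspace V}).

Lemma quotv_pi_linear : linear (quotv_pi U).
Proof. by move=> a x y; rewrite quotv_piD quotv_piZ. Qed.

Lemma quotv_pi0 : quotv_pi U 0 = 0.
Proof.
have := quotv_piD U 0 0; rewrite addr0 => /eqP.
by rewrite -subr_eq subrr => /eqP <-.
Qed.

Lemma quotv_piN x : quotv_pi U (- x) = - quotv_pi U x.
Proof. by apply/eqP; rewrite -addr_eq0 -quotv_piD addNr quotv_pi0. Qed.

Lemma quotv_piB x y : quotv_pi U (x - y) = quotv_pi U x - quotv_pi U y.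
Proof. by rewrite quotv_piD quotv_piN. Qed.

Lemma repr_quotv_pi x : x - repr (quotv_pi U x) \in U.
Proof. by rewrite -quotv_piP quotv_piK. Qed.

End Quotient.

(** [quot_rep] acts on the chosen representative [repr]; as [p] is closed under the bracket, every
    representative gives the same class. *)
Lemma quot_rep_pi (K : fieldType) (g : lieAlgType K) (p : lieSubalg g)
    (x : subvs_of p) v :
  quot_rep x (quotv_pi p v) = quotv_pi p (lie (vsval x) v).
Proof.
apply/esym/quotv_piP; have := lie_linearr (vsval x) (-1) (repr (quotv_pi p v)) v.
rewrite !scaleN1r ![- _ + _]addrC => <-.
by apply: lieSubalgP; rewrite ?subvsP ?repr_quotv_pi.
Qed.

Lemma quot_repB (K : fieldType) (g : lieAlgType K) (p : lieSubalg g)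
    (x : subvs_of p) v w : quot_rep x (v - w) = quot_rep x v - quot_rep x w.
Proof.
rewrite -(quotv_piK v) -(quotv_piK w) -quotv_piB !quot_rep_pi -quotv_piB.
by congr quotv_pi; rewrite -scaleN1r addrC lie_linearr scaleN1r addrC.
Qed.

Lemma quot_rep0 (K : fieldType) (g : lieAlgType K) (p : lieSubalg g)
    (x : subvs_of p) : quot_rep x 0 = 0.
Proof. by rewrite -[X in quot_rep x X](subrr 0) quot_repB subrr. Qed.

(** Independence of the representative again, now because [phi] maps [p] into [q]. *)
Lemma quot_map_pi (K : fieldType) (g h : lieAlgType K) (phi : 'Hom(g, h))
    (p : lieSubalg g) (q : lieSubalg h) v : (phi @: p <= q)%VS ->
  quot_map phi q (quotv_pi p v) = quotv_pi q (phi v).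
Proof.
move=> pq; apply/esym/quotv_piP; rewrite -linearB.
by apply: (subvP pq); rewrite memv_img // repr_quotv_pi.
Qed.

Lemma vsval_restr (K : fieldType) (g h : lieAlgType K) (phi : 'Hom(g, h))
    (p : lieSubalg g) (q : lieSubalg h) (x : subvs_of p) : (phi @: p <= q)%VS ->
  vsval (restr phi q x) = phi (vsval x).
Proof. by move=> pq; rewrite vsprojK // (subvP pq) // memv_img ?subvsP. Qed.

Lemma ce_diff0 (K : fieldType) (P : lieAlgType K) (V : lmodType K)
    (rho : P -> V -> V) (f : ('I_0 -> P) -> V) x :
  ce_diff rho f x = rho (x ord0) (f (fun k => x (lift ord0 k))).
Proof.
rewrite /ce_diff !big_ord_recl !big_ord0 expr0 scale1r !addr0.
by rewrite big_pred0 ?addr0 // => j; rewrite (ord1 j).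
Qed.

(** Counting from 0, the action terms have signs 1 and -1, and the only pair of indices, 0 and 1,
    has sign -1. *)
Lemma ce_diff1 (K : fieldType) (P : lieAlgType K) (V : lmodType K)
    (rho : P -> V -> V) (f : P -> V) (x : 'I_2 -> P) :
  ce_diff rho (fun y : 'I_1 -> P => f (y ord0)) x
  = rho (x ord0) (f (x ord_max)) - rho (x ord_max) (f (x ord0))
    - f (lie (x ord0) (x ord_max)).
Proof.
have E1 : lift ord0 ord0 = ord_max :> 'I_2 by apply: val_inj.
have E2 : lift (lift ord0 ord0) ord0 = ord0 :> 'I_2 by apply: val_inj.
rewrite /ce_diff !big_ord_recl !big_ord0 /= !addr0.
rewrite big_mkcond !big_ord_recl big_ord0 /= big_mkcond !big_ord_recl big_ord0 /=.
by rewrite /bracket_slots /= !expr0 !expr1 !addr0 !add0r !scale1r !scaleN1r E2 E1.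
Qed.

Section Cocycle.
Variables (R : realType) (g : lieAlgType R) (d : nat) (p : lieSubalg g).
Variable pt : R -> {vspace g}.
Hypotheses (pt_smooth : smooth_grassmannian_curve d pt) (pt0 : pt 0 = p).

(** The curve [a *: f t + k t] stays in [pt t] and starts at [a *: x + y]. *)
Lemma velocity0_linear : linear (@velocity0 _ _ p pt).
Proof.
move=> a x y.
have [e [f [f' [e0 f0 df fpt ->]]]] := velocity0_frame pt_smooth pt0 x.
have [e1 [k [k' [e10 k0 dk kpt ->]]]] := velocity0_frame pt_smooth pt0 y.
rewrite -quotv_pi_linear.
apply: (velocity0_curve pt_smooth (f := fun t => a *: f t + k t)
  (e := Num.min e e1) pt0).
- by rewrite lt_min e0.
- by rewrite f0 k0 linearP.
- apply: vderive0D dk; apply: vderive0_lin df => b u v.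
  by rewrite scalerDr !scalerA mulrC.
- move=> t; rewrite lt_min => /and3P[t0 te te1].
  by rewrite memvD ?memvZ ?fpt ?kpt ?t0.
Qed.

Lemma velocity0_lie (x y : subvs_of p) :
  (forall t, 0 <= t <= 1 -> is_lie_subalgebra (pt t)) ->
  velocity0 pt (lie x y)
  = quot_rep x (velocity0 pt y) - quot_rep y (velocity0 pt x).
Proof.
move=> lie_pt.
have [e [f [f' [e0 f0 df fpt ->]]]] := velocity0_frame pt_smooth pt0 x.
have [e1 [k [k' [e10 k0 dk kpt ->]]]] := velocity0_frame pt_smooth pt0 y.
(* Antisymmetry gives the right-hand side the form [lie f' (k 0) + lie (f 0) k'] of the product
   rule. *)
rewrite !quot_rep_pi -quotv_piB -f0 -k0 -lieC addrC.
apply: (velocity0_curve pt_smooth (f := fun t => lie (f t) (k t))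
  (e := Num.min 1 (Num.min e e1)) pt0).
- by rewrite !lt_min ltr01 e0.
- by rewrite f0 k0 vsval_subvs_lie.
- apply: (vderive0_app (L := fun t => lie (f t)) (D := lie f')) => //.
  + by move=> t; exact: lie_linearr.
  + exact: lie_linearr.
  + by move=> v; exact: vderive0_lin (lie_linearl v) df.
- move=> t; rewrite !lt_min => /and4P[t0 /ltW t1 te te1].
  by apply: lie_pt; rewrite ?t0 ?fpt ?kpt ?t0.
Qed.

(** The curve [phi (f t)] runs in [qt t]; this yields the third component of the cocycle
    equation. *)
Lemma velocity0_morphism (h : lieAlgType R) (l : nat) (q : lieSubalg h) qt
    (phi : 'Hom(g, h)) (x : subvs_of p) : (phi @: p <= q)%VS ->
  smooth_grassmannian_curve l qt -> qt 0 = q ->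
  (forall t, 0 <= t <= 1 -> (phi @: pt t <= qt t)%VS) ->
  velocity0 qt (restr phi q x) = quot_map phi q (velocity0 pt x).
Proof.
move=> phi_pq sq qt0 pqt.
have [e [f [f' [e0 f0 df fpt ->]]]] := velocity0_frame pt_smooth pt0 x.
rewrite quot_map_pi //.
apply: (velocity0_curve sq (f := fun t => phi (f t)) (e := Num.min 1 e) qt0).
- by rewrite lt_min ltr01.
- by rewrite f0 vsval_restr.
- by apply: vderive0_lin df => a u v; rewrite linearP.
- move=> t; rewrite lt_min => /and3P[t0 /ltW t1 te].
  by apply: (subvP (pqt t _)); rewrite ?t0 // memv_img ?fpt ?t0.
Qed.

End Cocycle.

Lemma alternating_multilinear1 (K : fieldType) (P V : lmodType K) (f : P -> V) :
  linear f -> alternating_multilinear (fun x : 'I_1 -> P => f (x ord0)).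
Proof.
move=> lf; split=> [x i a u v|x i j]; last by rewrite !ord1.
by rewrite /slot_set !ord1 !eqxx lf.
Qed.

Lemma deformation_cocycle (R : realType) (g h : lieAlgType R) (phi : 'Hom(g, h))
    (p : lieSubalg g) (q : lieSubalg h) (pt : R -> {vspace g})
    (qt : R -> {vspace h}) : (phi @: p <= q)%VS ->
  is_deformation phi p q pt qt -> mla_cocycle (deformation_cochain phi p q pt qt).
Proof.
move=> phi_pq [sp sq pt0 qt0 pqt]; split.
  split=> /=; [| |by split=> [*|//]; rewrite scaler0 addr0].
    exact/alternating_multilinear1/(velocity0_linear sp).
  exact/alternating_multilinear1/(velocity0_linear sq).
congr (_, _, _); apply/funext => x /=.
- rewrite ce_diff1 (velocity0_lie sp pt0) ?subrr // => t t01.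
  by have [] := pqt t t01.
- rewrite ce_diff1 (velocity0_lie sq qt0) ?subrr // => t t01.
  by have [] := pqt t t01.
(* The third entry of the cochain is 0, and so is its differential; only the compatibility of the
   two velocities remains. *)
- rewrite ce_diff0 (velocity0_morphism sp pt0 _ phi_pq sq qt0).
    by rewrite subrr sub0r quot_rep0 oppr0.
  by move=> t t01; have [] := pqt t t01.
Qed.

(** * Differentials of locally equal maps and of products *)

Lemma near_eq_is_diff (R : realType) (U W : normedModType R) (f g : U -> W) df x :
  (\forall y \near x, f y = g y) -> is_diff x f df -> is_diff x g df.
Proof.
move=> fg [dif dfE].
(* The first-order expansion of [f] at [x] is also one of [g], so differentiability and differential
   carry over. *)
have H : g \o shift x = cst (g x) + 'd f x +o_ 0 id.
  apply/eqaddoP => e e0.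
  have /eqaddoP /(_ e e0) := diff_locally dif.
  have : \forall h \near 0, f (shift x h) = g (shift x h).
    by rewrite (near_shift 0 x) in fg; move: fg; rewrite subr0.
  apply: filter_app2; apply: nearW => h /= fgh.
  rewrite -(nbhs_singleton fg).
  rewrite /= -![(_ + _ : _ -> _) _]/(_ + _) -![(- _ : _ -> _) _]/(- _) /=.
  by rewrite -fgh.
have dgE := diff_unique (diff_continuous dif) H.
apply: DiffDef; last by rewrite dgE.
by apply/diff_locallyP; rewrite dgE; split => //; exact: diff_continuous.
Qed.

Lemma differentiable_near_eq (R : realType) (U W : normedModType R)
    (f g : U -> W) x :
  (\forall y \near x, f y = g y) -> differentiable f x -> differentiable g x.
Proof. by move=> fg /differentiableP /(near_eq_is_diff fg) []. Qed.

Lemma diff_near_eq (R : realType) (U W : normedModType R) (f g : U -> W) x v :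
  (\forall y \near x, f y = g y) -> differentiable f x -> 'd g x v = 'd f x v.
Proof. by move=> fg /differentiableP /(near_eq_is_diff fg) [_ ->]. Qed.

Lemma differentiable_scale (R : realType) (U : normedModType R) n
    (k : U -> R) (f : U -> 'rV[R]_n) x :
  differentiable k x -> differentiable f x ->
  differentiable (fun y => k y *: f y) x.
Proof.
move=> dk df.
rewrite (_ : (fun y => _) = \sum_j (fun y => (k y * f y 0 j) *: delta_mx 0 j)).
  apply: differentiable_sum => j; apply: differentiableZl.
  apply: differentiableM => //.
  exact: (@differentiable_comp _ _ _ _ f (fun N : 'rV[R]_n => N 0 j : R) x df
    (differentiable_coord _ _ _)).
apply/funext => y; rewrite fct_sumE {1}[f y]row_sum_delta scaler_sumr.
by apply: eq_bigr => j _; rewrite scalerA.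
Qed.

Lemma linear_row_sum (R : realType) (W : lmodType R) n (f : 'rV[R]_n -> W) v :
  linear f -> f v = \sum_j v 0 j *: f (delta_mx 0 j).
Proof.
move=> lf; pose fL : {linear 'rV[R]_n -> W} :=
  HB.pack f (GRing.isLinear.Build _ _ _ _ f lf).
have fE u : f u = fL u by [].
rewrite fE {1}[v]row_sum_delta linear_sum; apply: eq_bigr => j _.
by rewrite linearZ.
Qed.

Lemma linear_pair0 (R : realType) (U V W : lmodType R)
    (f : {linear (U * V)%type -> W}) : linear (fun u => f (u, 0)).
Proof.
move=> k u v; rewrite -linearP; congr (f _).
by congr pair; rewrite /= scaler0 addr0.
Qed.

Lemma is_derive_vderive0 (R : realType) (V : vectType R) (f : R -> V) v :
  is_derive (0 : R) (1 : R) (fun t => coords (f t)) (coords v) -> vderive0 f v.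
Proof.
move=> [df dE]; rewrite -[v]coordsK -dE -derive1E.
exact: derivable_vderive0.
Qed.

(** * Inverse charts near a point *)

Section Chart.
Variables (R : realType) (M : topologicalType) (n : nat) (a : chart R M n).
Variable x : M.
Hypothesis ax : chart_dom a x.

Lemma near_chart_img : \forall u \near a x,
  [/\ (a @` chart_dom a) u, chart_dom a (chart_inv a u)
     & a (chart_inv a u) = u].
Proof.
have : nbhs (a x) (a @` chart_dom a).
  by apply: open_nbhs_nbhs; split; [exact: chart_img_open|exists x].
by apply: filterS => u au; split => //; case: au => y ay <-; rewrite chart_invK.
Qed.

(** The chart image is open, so continuity within it is ordinary continuity at [a x]. *)
Lemma chart_inv_cvg : chart_inv a u @[u --> a x] --> x.
Proof.
have := @chart_inv_continuous _ _ _ a.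
rewrite continuous_open_subspace; last exact: chart_img_open.
move=> /(_ (a x)); rewrite inE => /(_ _)/wrap[].
  by exists x.
by rewrite /continuous_at chart_invK.
Qed.

End Chart.

(** * Differentiability of the adjoint representation *)

Section GroupLaws.
Variables (R : realType) (n : nat) (G : lieGroup R n).
Local Notation e := (lg_one G).

(** The axioms give left laws only; multiply on the left by [lg_inv (lg_inv x)], the left inverse of
    [lg_inv x]. *)
Lemma lg_mulgV (x : G) : lg_mul x (lg_inv x) = e.
Proof.
rewrite -[LHS]lg_mul1 -[in LHS](lg_mulV (lg_inv x)) -lg_mulA.
by rewrite [lg_mul (lg_inv x) _]lg_mulA lg_mulV lg_mul1 lg_mulV.
Qed.

Lemma lg_mulg1 (x : G) : lg_mul x e = x.
Proof. by rewrite -(lg_mulV x) lg_mulA lg_mulgV lg_mul1. Qed.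

Lemma lg_inv1 : lg_inv e = e.
Proof. by rewrite -[LHS]lg_mul1 lg_mulgV. Qed.

Lemma lg_idem1 (x : G) : lg_mul x x = x -> x = e.
Proof. by move=> xx; rewrite -[x]lg_mul1 -(lg_mulV x) -lg_mulA xx. Qed.

End GroupLaws.

Section Adjoint.
Variables (R : realType) (n : nat) (G : lieGroup R n) (V : vectType R).
Variable TG : tangent_frame G V.
Local Notation e := (lg_one G).
Local Notation a := (tf_chart TG).
Local Notation ainv := (chart_inv a).
Local Notation x0 := (a e).

Let a_e : chart_dom a e := tf_chart_one TG.

Let P u := [/\ (a @` chart_dom a) u, chart_dom a (ainv u) & a (ainv u) = u].

Lemma tf_chart_invK1 : ainv x0 = e.
Proof. exact: chart_invK. Qed.

Lemma tf_isoK : cancel (tf_iso TG) (tf_iso TG)^-1%VF.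
Proof. by apply: lker0_lfunK; rewrite tf_iso_inj. Qed.

Lemma tf_isoVK : cancel (tf_iso TG)^-1%VF (tf_iso TG).
Proof. by move=> u; rewrite limg_lfunVK // tf_iso_surj memvf. Qed.

Definition local_mul (u : 'rV[R]_n * 'rV[R]_n) : 'rV[R]_n :=
  a (lg_mul (ainv u.1) (ainv u.2)).

Definition local_inv (u : 'rV[R]_n) : 'rV[R]_n := a (lg_inv (ainv u)).

(** Shaped as in [smooth_map2], so that smoothness of [local_mul] on it is an instance of the Lie
    group axiom. *)
Let dom_mul : set ('rV[R]_n * 'rV[R]_n) :=
  (fun z : G * G => (a z.1, a z.2)) @`
    ((chart_dom a `*` chart_dom a) `&`
     (fun z : G * G => lg_mul z.1 z.2) @^-1` chart_dom a).

Let dom_inv : set 'rV[R]_n :=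
  a @` (chart_dom a `&` (@lg_inv _ _ G) @^-1` chart_dom a).

Let dom_mulP u : dom_mul u -> ainv (local_mul u) = lg_mul (ainv u.1) (ainv u.2).
Proof. by move=> [z [[z1 z2] zz] <-]; rewrite /local_mul /= !chart_invK. Qed.

Let dom_invP u : dom_inv u -> ainv (local_inv u) = lg_inv (ainv u).
Proof. by move=> [z [z1 zz] <-]; rewrite /local_inv /= !chart_invK. Qed.

(** By continuity of the multiplication, products of points near [e] stay in the open chart
    domain. *)
Let near_dom_mul : \forall u \near (x0, x0), dom_mul u.
Proof.
have c : (ainv u.1, ainv u.2) @[u --> (x0, x0)] --> (e, e).
  apply: cvg_pair.
    by apply: (cvg_comp (fun u => u.1) ainv) (chart_inv_cvg a_e); exact: cvg_fst.
  by apply: (cvg_comp (fun u => u.2) ainv) (chart_inv_cvg a_e); exact: cvg_snd.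
have [cm _] := lg_mul_smooth G.
have ce : lg_mul (ainv u.1) (ainv u.2) @[u --> (x0, x0)] --> e.
  by have := cvg_comp _ _ c (cm (e, e)); rewrite /= lg_mul1; apply.
have H : \forall u \near (x0, x0), chart_dom a (lg_mul (ainv u.1) (ainv u.2)).
  by apply: ce; apply: open_nbhs_nbhs; split => //; exact: chart_dom_open.
have c1 : u.1 @[u --> (x0, x0)] --> x0 by exact: cvg_fst.
have c2 : u.2 @[u --> (x0, x0)] --> x0 by exact: cvg_snd.
have H1 : \forall u \near (x0, x0), P u.1 by exact: (c1 P (near_chart_img a_e)).
have H2 : \forall u \near (x0, x0), P u.2 by exact: (c2 P (near_chart_img a_e)).
near=> u.
have [_ d1 e1] : P u.1 by near: u.
have [_ d2 e2] : P u.2 by near: u.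
have dm : chart_dom a (lg_mul (ainv u.1) (ainv u.2)) by near: u.
by exists (ainv u.1, ainv u.2) => //=; rewrite e1 e2 -surjective_pairing.
Unshelve. all: by end_near. Qed.

Let near_dom_inv : \forall u \near x0, dom_inv u.
Proof.
have [ci _] := lg_inv_smooth G.
have ce : lg_inv (ainv u) @[u --> x0] --> e.
  by have := cvg_comp _ _ (chart_inv_cvg a_e) (ci e); rewrite lg_inv1; apply.
have H : \forall u \near x0, chart_dom a (lg_inv (ainv u)).
  by apply: ce; apply: open_nbhs_nbhs; split => //; exact: chart_dom_open.
near=> u; have [_ du ue] : P u by near: u; exact: near_chart_img.
by exists (ainv u) => //; split => //; near: u.
Unshelve. all: by end_near. Qed.

Let local_mul_smooth : smooth_on dom_mul local_mul.
Proof. by have [_] := lg_mul_smooth G; apply; exact: tf_chart_atlas. Qed.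

Let local_inv_smooth : smooth_on dom_inv local_inv.
Proof. by have [_] := lg_inv_smooth G; apply; exact: tf_chart_atlas. Qed.

Let diff_local_mul u : dom_mul u -> differentiable local_mul u.
Proof. by have [H _] := local_mul_smooth 1; exact: H. Qed.

Let diff2_local_mul u v : dom_mul u ->
  differentiable (fun w => 'd local_mul w v) u.
Proof. by have [_ /(_ v)[H _]] := local_mul_smooth 2; exact: H. Qed.

Let diff_local_inv u : dom_inv u -> differentiable local_inv u.
Proof. by have [H _] := local_inv_smooth 1; exact: H. Qed.

Lemma local_inv1 : local_inv x0 = x0.
Proof. by rewrite /local_inv tf_chart_invK1 lg_inv1. Qed.

(** [linfun] returns the given function only when it is linear; here linearity comes from the
    differential. *)
Lemma AdE x u : Ad TG x u = tf_iso TG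
  (tf_diff1 TG (fun y : G => a (lg_mul (lg_mul x y) (lg_inv x))) u).
Proof.
rewrite /Ad; set f := (fun u => _).
have lf : linear f by move=> k v w; rewrite /f /tf_diff1 !linearP.
exact: (lfunE (HB.pack f (GRing.isLinear.Build _ _ _ _ f lf) : {linear _ -> _})).
Qed.

Lemma Ad1 : Ad TG e = \1%VF.
Proof.
apply/lfunP => u; rewrite AdE id_lfunE /tf_diff1 -[RHS]tf_isoVK; congr (tf_iso TG _).
have -> : (fun y : G => a (lg_mul (lg_mul e y) (lg_inv e))) = a.
  by apply/funext => y; rewrite lg_mul1 lg_inv1 lg_mulg1.
(* [a] composed with its inverse is the identity on the chart image, hence near [x0]. *)
rewrite (@diff_near_eq _ _ _ id) //.
  by rewrite (@diff_val _ _ _ _ _ _ _ (is_diff_id x0)).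
by apply: filterS (near_chart_img a_e) => y [].
Qed.

(** Conjugation by [y] reads [K z = m (m (y, z), i y)] in the chart, and the chain rule is applied
    at [z = x0]. *)
Let near_AdE u : \forall y \near x0, Ad TG (ainv y) u = tf_iso TG
  ('d local_mul (y, local_inv y)
     ('d local_mul (y, x0) (0, (tf_iso TG)^-1%VF u), 0)).
Proof.
have cid : y @[y --> x0] --> x0 by exact: cvg_id.
(* A whole neighbourhood of [(y, x0)] lies in [dom_mul]; this lets [K] replace conjugation for [z]
   near [x0]. *)
have near_pair : \forall y \near x0, \forall u \near (y, x0), dom_mul u.
  have c : (y, x0) @[y --> x0] --> (x0, x0) by exact: (cvg_pair cid (cvg_cst x0)).
  exact: (c (fun u => nbhs u dom_mul) (near_join near_dom_mul)).
have near_inv : \forall y \near x0, dom_mul (y, local_inv y).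
  have ci : local_inv y @[y --> x0] --> x0.
    rewrite -{2}local_inv1; apply/differentiable_continuous/diff_local_inv.
    exact: nbhs_singleton near_dom_inv.
  have c : (y, local_inv y) @[y --> x0] --> (x0, x0) by exact: (cvg_pair cid ci).
  exact: (c dom_mul near_dom_mul).
near=> y; rewrite AdE /tf_diff1; set w := (_^-1)%VF u; congr (tf_iso TG _).
have yx0 : \forall u \near (y, x0), dom_mul u by near: y.
have yy : dom_mul (y, local_inv y) by near: y.
have iy : dom_inv y by near: y; exact: near_dom_inv.
have [_ _ ye] : P y by near: y; exact: near_chart_img.
(* At [z = x0] the inner product is [y], so the outer differential is taken at
   [(y, local_inv y)]. *)
have my : local_mul (y, x0) = y.
  by rewrite /local_mul /= tf_chart_invK1 lg_mulg1.
pose K z := local_mul (local_mul (y, z), local_inv y).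
have dK1 : is_diff x0 (fun z => local_mul (y, z))
    (fun v => 'd local_mul (y, x0) (0, v)).
  apply: (is_diff_comp (is_diff_pair (is_diff_cst y x0) (is_diff_id x0))).
  by apply/differentiableP/diff_local_mul; exact: nbhs_singleton yx0.
have dK : is_diff x0 K (fun v =>
    'd local_mul (y, local_inv y) ('d local_mul (y, x0) (0, v), 0)).
  apply: (is_diff_comp (is_diff_pair dK1 (is_diff_cst (local_inv y) x0))).
  by rewrite my; apply/differentiableP/diff_local_mul.
rewrite (@diff_near_eq _ _ _ K).
- by rewrite (@diff_val _ _ _ _ _ _ _ dK).
- have c : (y, z) @[z --> x0] --> (y, x0) by exact: (cvg_pair (cvg_cst y) cid).
  have H : \forall z \near x0, dom_mul (y, z) by exact: (c dom_mul yx0).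
  near=> z; have yz : dom_mul (y, z) by near: z.
  by rewrite /K /= {1}/local_mul /= dom_mulP // dom_invP.
- by have [] := dK.
Unshelve. all: by end_near. Qed.

(** By [near_AdE] the map is built from partial differentials of [local_mul], which is twice
    differentiable; applied to a fixed vector, each of them is differentiable in [y]. *)
Lemma Ad_differentiable u :
  differentiable (fun y => coords (Ad TG (ainv y) u)) x0.
Proof.
pose w := (tf_iso TG)^-1%VF u.
pose D y := 'd local_mul (y, local_inv y) ('d local_mul (y, x0) (0, w), 0).
have d00 : dom_mul (x0, x0) by exact: nbhs_singleton near_dom_mul.
have di : differentiable local_inv x0.
  by apply: diff_local_inv; exact: nbhs_singleton near_dom_inv.
have dD : differentiable D x0.
  (* The argument of the outer differential moves with [y]; expanding it in the standard basis
     leaves scalar coefficients and differentials at fixed vectors. *)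
  rewrite (_ : D = \sum_j (fun y => 'd local_mul (y, x0) (0, w) 0 j *:
      'd local_mul (y, local_inv y) (delta_mx 0 j, 0))); last first.
    apply/funext => y; rewrite fct_sumE.
    exact: (linear_row_sum _ (linear_pair0 ('d local_mul (y, local_inv y)))).
  apply: differentiable_sum => j; apply: differentiable_scale.
    apply: (@differentiable_comp _ _ _ _ (fun y => 'd local_mul (y, x0) (0, w))
      (fun N : 'rV[R]_n => N 0 j : R)); last exact: differentiable_coord.
    apply: (@differentiable_comp _ _ _ _ (fun y => (y, x0))
      (fun v => 'd local_mul v (0, w))); last exact: diff2_local_mul.
    by apply: differentiable_pair => //; exact: differentiable_cst.
  apply: (@differentiable_comp _ _ _ _ (fun y => (y, local_inv y))
    (fun v => 'd local_mul v (delta_mx 0 j, 0))).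
    exact: differentiable_pair.
  by rewrite local_inv1; exact: diff2_local_mul.
pose M := lin1_mx (@coords R V \o tf_iso TG).
apply: (differentiable_near_eq (f := fun y => D y *m M)); last first.
  apply: (@differentiable_comp _ _ _ _ D (fun z => z *m M)) => //.
  exact: mulmx_differentiable.
near=> y; rewrite mul_rV_lin1 /=; congr coords; apply/esym.
by near: y; exact: near_AdE.
Unshelve. all: by end_near. Qed.

End Adjoint.

(** * Equivalent deformations *)

Section Curve.
Variables (R : realType) (n : nat) (M : manifold R n).

(** Smoothness provides some chart [b] at [c 0]; the transition map carries the curve to the
    prescribed chart [a]. *)
Lemma manifold_curve_chart (a : chart R M n) (c : R -> M) : atlas a ->
  chart_dom a (c 0) -> smooth_manifold_curve c ->
  exists (f : R -> 'rV[R]_n) (r : R),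
    [/\ 0 < r, differentiable f (0 : R), f 0 = a (c 0)
      & forall t, 0 <= t < r -> c t = chart_inv a (f t)].
Proof.
move=> aa ac0 sc; have [|b [f [r [[ab sf r0] cf]]]] := sc 0.
  by rewrite lexx ler01.
have [bc0 f0] : chart_dom b (c 0) /\ b (c 0) = f 0.
  by apply: cf; rewrite ?lexx ?ler01 // subrr normr0.
have df : differentiable f (0 : R) by have [H _] := sf 1; exact: H.
have near_a : \forall t \near (0 : R), chart_dom a (chart_inv b (f t)).
  have c1 : f t @[t --> (0 : R)] --> b (c 0).
    by rewrite f0; exact: differentiable_continuous.
  have c2 := cvg_comp _ _ c1 (chart_inv_cvg bc0).
  apply: (c2 (chart_dom a)); apply: open_nbhs_nbhs; split => //.
  exact: chart_dom_open.
have [r1 /= r10 Hr1] := near_a.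
(* [r] keeps the curve in the chart [b], [r1] in the domain of [a], and 1 keeps [t] in [[0, 1]]. *)
exists (a \o chart_inv b \o f), (Num.min r (Num.min r1 1)); split.
- by rewrite !lt_min r0 r10 ltr01.
- apply: differentiable_comp => //.
  have [H _] := atlas_compatible ab aa 1; apply: H; exists (c 0) => //.
- by rewrite /= -f0 chart_invK.
- move=> t; rewrite !lt_min => /and4P[t0 tr tr1 /ltW t1].
  have [bct bf] : chart_dom b (c t) /\ b (c t) = f t.
    by apply: cf; rewrite ?t0 // subr0 ger0_norm.
  rewrite /= chart_invK; first by rewrite -bf chart_invK.
  by apply: Hr1; rewrite /= sub0r normrN ger0_norm.
Qed.
End Curve.

Section AdjointCurve.
Variables (R : realType) (n : nat) (G : lieGroup R n) (g : lieAlgType R).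
Variables (TG : tangent_frame G g) (f : R -> 'rV[R]_n).
Hypotheses (integ : integrates TG) (df : differentiable f (0 : R)).
Hypothesis f0 : f 0 = tf_chart TG (lg_one G).

(** Product rule for [Ad] along the curve: by [integrates], the derivative of [Ad] at 1 in the
    direction [u] is [lie u]. *)
Lemma vderive0_Ad (x : R -> g) x' : vderive0 x x' ->
  vderive0 (fun t => Ad TG (chart_inv (tf_chart TG) (f t)) (x t))
    (lie (tf_iso TG ('d f (0 : R) 1)) (x 0) + x').
Proof.
move=> dx; set u := tf_iso TG _.
(* [Ad] at 1 is the identity; this gives the second summand the form [L 0 x'] of [vderive0_app]. *)
have -> : x' = Ad TG (chart_inv (tf_chart TG) (f 0)) x'.
  by rewrite f0 tf_chart_invK1 Ad1 id_lfunE.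
apply: (vderive0_app (L := fun t => Ad TG (chart_inv (tf_chart TG) (f t)))
  (D := lie u)) => //.
- by move=> t k v w; rewrite linearP.
- exact: lie_linearr.
move=> v; apply: is_derive_vderive0.
pose F y := coords (Ad TG (chart_inv (tf_chart TG) y) v).
have dF : differentiable F (f 0) by rewrite f0; exact: Ad_differentiable.
apply: DeriveDef.
  by apply: diff_derivable; exact: (differentiable_comp df dF).
rewrite deriveE; last exact: (differentiable_comp df dF).
rewrite (@diff_comp _ _ _ _ f F) //= integ of_coordsK /tf_diff1.
by rewrite /u tf_isoK f0.
Qed.

End AdjointCurve.

Lemma morphism_one (R : realType) (m n : nat) (G : lieGroup R m)
    (H : lieGroup R n) (Phi : G -> H) :
  {morph Phi : x y / lg_mul x y >-> lg_mul x y} ->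
  Phi (lg_one G) = lg_one H.
Proof. by move=> Phi_mul; apply: lg_idem1; rewrite -Phi_mul lg_mul1. Qed.

(** By the chain rule, [Phi (c t)] has velocity [phi u] when [c] has velocity [u]. Hence a single
    element [u] accounts for both components of the coboundary. *)
Lemma morphism_curve (R : realType) (m n : nat) (G : lieGroup R m)
    (H : lieGroup R n) (g h : lieAlgType R) (TG : tangent_frame G g)
    (TH : tangent_frame H h) (phi : 'Hom(g, h)) (Phi : G -> H)
    (c : R -> G) (f : R -> 'rV[R]_m) (r : R) :
  integrates_morphism TG TH phi Phi -> 0 < r -> differentiable f (0 : R) ->
  f 0 = tf_chart TG (lg_one G) ->
  (forall t, 0 <= t < r -> c t = chart_inv (tf_chart TG) (f t)) ->
  exists (f' : R -> 'rV[R]_n) (r' : R),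
    [/\ 0 < r', differentiable f' (0 : R), f' 0 = tf_chart TH (lg_one H),
        tf_iso TH ('d f' (0 : R) 1) = phi (tf_iso TG ('d f (0 : R) 1))
      & forall t, 0 <= t < r' -> Phi (c t) = chart_inv (tf_chart TH) (f' t)].
Proof.
move=> [[cPhi sPhi] Phi_mul phiE] r0 df f0 cf.
have Phi1 := morphism_one Phi_mul.
pose a := tf_chart TG; pose b := tf_chart TH.
pose F := b \o Phi \o chart_inv a.
have dF : differentiable F (f 0).
  have [K _] := sPhi _ _ (tf_chart_atlas TG) (tf_chart_atlas TH) 1.
  apply: K; exists (lg_one G) => //; split; first exact: tf_chart_one.
  by rewrite /= Phi1; exact: tf_chart_one.
have near_b : \forall t \near (0 : R), chart_dom b (Phi (chart_inv a (f t))).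
  have c1 : f t @[t --> (0 : R)] --> a (lg_one G).
    by rewrite -f0; exact: differentiable_continuous.
  have c2 := cvg_comp _ _ c1 (chart_inv_cvg (tf_chart_one TG)).
  have c3 := cvg_comp _ _ c2 (cPhi (lg_one G)).
  apply: (c3 (chart_dom b)); apply: open_nbhs_nbhs; split => //.
    exact: chart_dom_open.
  by rewrite Phi1; exact: tf_chart_one.
have [r1 /= r10 Hr1] := near_b.
exists (F \o f), (Num.min r r1); split.
- by rewrite lt_min r0.
- exact: differentiable_comp.
- by rewrite /F /= f0 tf_chart_invK1 Phi1.
- by rewrite diff_comp //= phiE /tf_diff1 tf_isoK f0.
- move=> t; rewrite lt_min => /and3P[t0 tr tr1].
  rewrite cf ?t0 // /F /= chart_invK //.
  by apply: Hr1; rewrite /= sub0r normrN ger0_norm.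
Qed.

Lemma velocity0_conj (R : realType) (n : nat) (G : lieGroup R n)
    (g : lieAlgType R) (TG : tangent_frame G g) (p : lieSubalg g) (d : nat)
    (pt pt' : R -> {vspace g}) (c : R -> G) (f : R -> 'rV[R]_n) (r : R)
    (x : subvs_of p) :
  integrates TG -> smooth_grassmannian_curve d pt ->
  smooth_grassmannian_curve d pt' -> pt 0 = p -> pt' 0 = p -> 0 < r ->
  differentiable f (0 : R) -> f 0 = tf_chart TG (lg_one G) ->
  (forall t, 0 <= t < r -> c t = chart_inv (tf_chart TG) (f t)) ->
  (forall t, 0 <= t <= 1 -> pt' t = (Ad TG (c t) @: pt t)%VS) ->
  velocity0 pt x = velocity0 pt' x
    + quot_rep x (quotv_pi p (tf_iso TG ('d f (0 : R) 1))).
Proof.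
move=> integ sp sp' pt0 pt0' r0 df f0 cf ptc.
have [e [k [k' [e0 k0 dk kpt ->]]]] := velocity0_frame sp pt0 x.
rewrite quot_rep_pi; set u := tf_iso TG _.
rewrite (@velocity0_curve _ _ _ _ sp' _ _
  (fun t => Ad TG (chart_inv (tf_chart TG) (f t)) (k t)) (lie u (k 0) + k')
  (Num.min 1 (Num.min e r)) pt0').
(* The bracket [lie u x] produced by conjugation cancels against the action of [x] on the class of
   [u]. *)
- by rewrite -quotv_piD k0 lieC addrAC addNr add0r.
- by rewrite !lt_min ltr01 e0.
- by rewrite f0 tf_chart_invK1 Ad1 id_lfunE.
- exact: vderive0_Ad.
- move=> t; rewrite !lt_min => /and4P[t0 /ltW t1 te tr].
  by rewrite -cf ?t0 // ptc ?t0 // memv_img // kpt ?t0.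
Qed.

(** * Equality of cohomology classes *)

Lemma mla_class_eq (K : fieldType) (g h : lieAlgType K) (phi : 'Hom(g, h))
    (p : lieSubalg g) (q : lieSubalg h)
    (c c' : mla_ambient (sub_mla_data phi p q) 1) (u : g) :
  (phi @: p <= q)%VS ->
  c - c' = @mla_diff K (sub_mla_data phi p q) 0 (quotv_pi p u) ->
  mla_class c = mla_class c'.
Proof.
move=> pq ccu.
have dB v w : @mla_diff K (sub_mla_data phi p q) 0 (quotv_pi p (v - w))
   = @mla_diff K (sub_mla_data phi p q) 0 (quotv_pi p v)
     - @mla_diff K (sub_mla_data phi p q) 0 (quotv_pi p w).
  congr (_, _, _); last by rewrite subr0.
  - apply/funext => x; rewrite -[RHS]/(ce_diff _ _ x - ce_diff _ _ x).
    by rewrite !ce_diff0 /= quotv_piB quot_repB.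
  - apply/funext => x; rewrite -[RHS]/(ce_diff _ _ x - ce_diff _ _ x).
    by rewrite !ce_diff0 /= !quot_map_pi // linearB quotv_piB quot_repB.
apply/seteqP; split => b [cb [v _ vE]]; split => //.
(* From [b - c' = (b - c) + (c - c')]: the primitive [v] is shifted by [u], and by [- u] in the
   converse direction. *)
- exists (quotv_pi p (repr v + u)) => //.
  rewrite -[b - c'](subrKA c) ccu -vE -{2}(quotv_piK v).
  by rewrite -[repr v in RHS](addrK u) dB subrK.
- exists (quotv_pi p (repr v - u)) => //.
  by rewrite dB quotv_piK vE -ccu opprB subrKA.
Qed.

Lemma deformation_class (R : realType) (g h : lieAlgType R) (phi : 'Hom(g, h))
    (p : lieSubalg g) (q : lieSubalg h) (phi_pq : (phi @: p <= q)%VS)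
    (m n : nat) (G : lieGroup R m) (H : lieGroup R n)
    (TG : tangent_frame G g) (TH : tangent_frame H h) (Phi : G -> H)
    (pt pt' : R -> {vspace g}) (qt qt' : R -> {vspace h}) :
  integrates TG -> integrates TH -> integrates_morphism TG TH phi Phi ->
  is_deformation phi p q pt qt -> is_deformation phi p q pt' qt' ->
  equivalent_deformations TG TH Phi pt qt pt' qt' ->
  mla_class (deformation_cochain phi p q pt qt)
  = mla_class (deformation_cochain phi p q pt' qt').
Proof.
move=> iG iH iPhi [sp sq pt0 qt0 _] [sp' sq' pt0' qt0' _] [c [sc c0 cE]].
have dom0 : chart_dom (tf_chart TG) (c 0) by rewrite c0; exact: tf_chart_one.
have [f [r [r0 df f0 cf]]] := manifold_curve_chart (tf_chart_atlas TG) dom0 sc.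
rewrite c0 in f0.
have [f' [r' [r0' df' f0' f'E cf']]] := morphism_curve iPhi r0 df f0 cf.
(* The cochains differ by the coboundary of the class of the velocity of [c] at 0. *)
apply: (mla_class_eq (u := tf_iso TG ('d f (0 : R) 1)) phi_pq).
congr (_, _, _); last by rewrite subr0.
- apply/funext => x; rewrite ce_diff0.
  rewrite -[LHS]/(velocity0 pt (x ord0) - velocity0 pt' (x ord0)).
  rewrite (velocity0_conj _ iG sp sp' pt0 pt0' r0 df f0 cf).
    by rewrite addrAC subrr add0r.
  by move=> t /cE[].
(* [f'E] turns [phi u] into the velocity of [Phi (c t)], so the conjugation formula applies in [h]
   as it did in [g]. *)
- apply/funext => x; rewrite ce_diff0 /= quot_map_pi // -f'E.
  rewrite -[LHS]/(velocity0 qt (x ord0) - velocity0 qt' (x ord0)).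
  rewrite (velocity0_conj _ iH sq sq' qt0 qt0' r0' df' f0' cf').
    by rewrite addrAC subrr add0r.
  by move=> t /cE[].
Qed.

Theorem theorem4p9 (R : realType) (g h : lieAlgType R) (phi : 'Hom(g, h))
    (phi_morph : is_lie_morphism phi) (p : lieSubalg g) (q : lieSubalg h)
    (phi_pq : (phi @: p <= q)%VS) :
  (forall (pt : R -> {vspace g}) (qt : R -> {vspace h}),
     is_deformation phi p q pt qt ->
     mla_cocycle (deformation_cochain phi p q pt qt)) /\
  (forall (m n : nat) (G : lieGroup R m) (H : lieGroup R n)
     (TG : tangent_frame G g) (TH : tangent_frame H h) (Phi : G -> H),
     simply_connected R G -> simply_connected R H ->
     integrates TG -> integrates TH ->
     integrates_morphism TG TH phi Phi ->
   forall (pt pt' : R -> {vspace g}) (qt qt' : R -> {vspace h}),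
     is_deformation phi p q pt qt ->
     is_deformation phi p q pt' qt' ->
     equivalent_deformations TG TH Phi pt qt pt' qt' ->
     mla_class (deformation_cochain phi p q pt qt)
     = mla_class (deformation_cochain phi p q pt' qt')).
Proof.
split; first by move=> pt qt; exact: deformation_cocycle.
move=> m n G H TG TH Phi _ _ iG iH iPhi pt pt' qt qt' dpt dpt'.
exact: deformation_class iG iH iPhi dpt dpt'.
Qed.
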